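(* For all $h>0$, integers $r\ge 2$ and $0<\mu\le 1$ there is a constant $c_1$, depending only on $h$, $r$, $\mu$, such that the following holds. Let $\Lambda$ be a finite lattice with $N$ sites carrying a quantum system $(H_\Lambda, C_\Lambda, O^{(1)}_\Lambda, O^{(2)}_\Lambda)$ with a $U(1)$ symmetry, and let $\Phi_\Lambda$ be a normalized simultaneous eigenstate of $H_\Lambda$ and $C_\Lambda$ with $H_\Lambda\Phi_\Lambda=E_\Lambda\Phi_\Lambda$, such that conditions i)–iv) of the context hold with constants $h,o,r,\mu$. Let $M$ be a nonzero integer, and suppose $$N\ge\left(\frac{4r}{\mu}\right)^2,\qquad \frac{|M|}{N}\le\frac{\mu^2}{8r}.$$ Then $(O^+_\Lambda)^M\Phi_\Lambda\neq0$, so that the state $$\Psi^{(M)}_\Lambda:=\frac{(O^+_\Lambda)^M\Phi_\Lambda}{\|(O^+_\Lambda)^M\Phi_\Lambda\|}$$ is well-defined, and $$\frac1N\left|(\Psi^{(M)}_\Lambda,H_\Lambda\Psi^{(M)}_\Lambda)-E_\Lambda\right|\le c_1\frac{|M|}{N}.$$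
   Context: Setting. $\Lambda$ is a finite set of $N$ sites; to each $x\in\Lambda$ is associated a finite-dimensional Hilbert space $\mathcal H_x$, and $\mathcal H_\Lambda=\bigotimes_{x\in\Lambda}\mathcal H_x$. $\|\cdot\|$ is the Hilbert space norm or the operator norm. The Hamiltonian is $H_\Lambda=\sum_{x\in\Lambda}h_x$ with each $h_x$ a self-adjoint operator on $\mathcal H_\Lambda$. $C_\Lambda$ is a self-adjoint operator on $\mathcal H_\Lambda$ with $[H_\Lambda,C_\Lambda]=0$. The order operators are $O^{(\alpha)}_\Lambda=\sum_{x\in\Lambda}o^{(\alpha)}_x$, $\alpha=1,2$, with each $o^{(\alpha)}_x$ self-adjoint on $\mathcal H_\Lambda$; they satisfy $$[O^{(1)}_\Lambda,C_\Lambda]=-iO^{(2)}_\Lambda,\qquad [O^{(2)}_\Lambda,C_\Lambda]=iO^{(1)}_\Lambda.$$ $O^\pm_\Lambda:=O^{(1)}_\Lambda\pm iO^{(2)}_\Lambda$, and for negative $M$ one sets $(O^+_\Lambda)^M:=(O^-_\Lambda)^{-M}=(O^-_\Lambda)^{|M|}$ (this is notation, not an inverse). Conditions: i) $[o^{(\alpha)}_x,o^{(\beta)}_y]=0$ for $x\ne y$ and $\alpha,\beta\in\{1,2\}$. ii) For each $x\in\Lambda$ there is a support set $\mathcal S_x\subset\Lambda$ with at most $r$ sites ($r\ge2$ an integer independent of $x$) such that $[h_x,o^{(\alpha)}_y]=0$ for $\alpha=1,2$ unless $y\in\mathcal S_x$. iii) $\|h_x\|\le h$ and $\|o^{(\alpha)}_x\|\le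 o$ for all $x\in\Lambda$, $\alpha=1,2$, with constants $h,o>0$ independent of $x$. iv) (Long range order) $(\Phi_\Lambda,(O^{(1)}_\Lambda)^2\Phi_\Lambda)=(\Phi_\Lambda,(O^{(2)}_\Lambda)^2\Phi_\Lambda)\ge(\mu oN)^2$ with a constant $0<\mu\le1$. *)

(* Defs.v *)
From mathcomp Require Export all_boot all_order all_algebra.
From mathcomp Require Export complex.
From mathcomp Require Export classical_sets reals.

Set Implicit Arguments.
Unset Strict Implicit.
Unset Printing Implicit Defensive.

Import Order.TTheory GRing.Theory Num.Theory.

Local Open Scope ring_scope.
Local Open Scope complex_scope.
Local Open Scope sesquilinear_scope.

(* The one-site space H_x is C^(d x); the tensor product of the H_x over x has
   as orthonormal basis the product basis vectors, one for each choice of a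
   basis index at every site. *)
Definition config (Lam : finType) (d : Lam -> nat) : finType :=
  {dffun forall x : Lam, 'I_(d x)}.

Definition state (R : realType) (Lam : finType) (d : Lam -> nat) :=
  'cV[R[i]]_#|config d|.

Definition operator (R : realType) (Lam : finType) (d : Lam -> nat) :=
  'M[R[i]]_#|config d|.

Section HilbertSpace.
Variables (R : realType) (n : nat).
Implicit Types (u v : 'cV[R[i]]_n) (A B : 'M[R[i]]_n).

(* Conjugate-linear in the first argument. *)
Definition inner u v : R[i] := (u ^t* *m v) 0 0.

Definition hnorm v : R := Num.sqrt (complex.Re (inner v v)).

Definition opnorm A : R :=
  sup [set hnorm (A *m v) | v in [set v | hnorm v <= 1]]%classic.

Definition comm A B : 'M[R[i]]_n := A *m B - B *m A.

Definition is_eigenstate A (a : R[i]) v : Prop := v != 0 /\ A *m v = a *: v.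

Definition normalize v : 'cV[R[i]]_n := ((hnorm v)^-1)%:C *: v.

End HilbertSpace.

(* The index alpha = 1, 2 of the order operators is represented by the elements
   0, 1 of 'I_2. *)
Record u1_system (R : realType) (Lam : finType) (d : Lam -> nat) := U1System {
  ham_loc : Lam -> operator R d;
  charge : operator R d;
  ord_loc : 'I_2 -> Lam -> operator R d;
  ham : operator R d := \sum_(x : Lam) ham_loc x;
  ord : 'I_2 -> operator R d := fun alpha => \sum_(x : Lam) ord_loc alpha x;
  ham_loc_selfadj : forall x, ham_loc x \is hermsymmx;
  charge_selfadj : charge \is hermsymmx;
  ord_loc_selfadj : forall alpha x, ord_loc alpha x \is hermsymmx;
  ham_charge : comm ham charge = 0;
  ord1_charge : comm (ord 0) charge = - ('i *: ord 1);
  ord2_charge : comm (ord 1) charge = 'i *: ord 0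
}.

Section TowerStates.
Variables (R : realType) (Lam : finType) (d : Lam -> nat).
Variable Q : u1_system R d.

Definition ord_plus : operator R d := ord Q 0 + 'i *: ord Q 1.
Definition ord_minus : operator R d := ord Q 0 - 'i *: ord Q 1.

(* (O^+)^M for an integer M; for M < 0 this is by convention (O^-)^|M|, not an
   inverse (recall that Negz k is - k.+1). *)
Definition ord_plus_pow (M : int) : operator R d :=
  match M with
  | Posz k => ord_plus ^+ k
  | Negz k => ord_minus ^+ k.+1
  end.

Definition tower_state (M : int) (Phi : state R d) : state R d :=
  normalize (ord_plus_pow M *m Phi).

End TowerStates.

(* Main.v *)
(** Let A be O^+ for M > 0 and O^- for M < 0.  By Cauchy-Schwarz,
    |A^m Phi|^4 <= |A^(m-1) Phi|^2 |A^* A^m Phi|^2, and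
    |A^* v|^2 <= |A v|^2 + |[A, A^*]| |v|^2 with |[A, A^*]| = O(o^2 N), so the
    ratios |A^(m+1) Phi|^2 / |A^m Phi|^2 start at order (mu o N)^2 by long range
    order and lose at most O(o^2 N) per step; they stay above (mu o N)^2 as
    long as m < |M|.  On the other hand A^M H - H A^M is a sum over k >= 1 of
    binom(M, k) ad_A^k(H) A^(M-k), and locality gives
    |ad_A^k(H)| <= h N (4 o r)^k.  Each commutator thus costs 4 o r but removes
    one A, worth mu o N, which leaves
    h N ((1 + 4 r / (mu N))^M - 1) = O(h r M / mu). *)
Require Import Defs.
From mathcomp Require Import ring lra.

Set Implicit Arguments.
Unset Strict Implicit.
Unset Printing Implicit Defensive.

Import Order.TTheory GRing.Theory Num.Theory.

Local Open Scope ring_scope.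
Local Open Scope complex_scope.
Local Open Scope sesquilinear_scope.

(** * Hilbert space norm, Cauchy-Schwarz and operator bounds *)

Lemma normc_ge0 (R : rcfType) (z : R[i]) : 0 <= Normc.normc z.
Proof. by case: z => a b; exact: sqrtr_ge0. Qed.

Lemma normc_real (R : rcfType) (a : R) : Normc.normc a%:C = `|a|.
Proof. by rewrite /= expr0n addr0 sqrtr_sqr. Qed.

Section HilbertSpaceTheory.
Variables (R : realType) (n : nat).
Implicit Types (u v : 'cV[R[i]]_n) (A B : 'M[R[i]]_n).

(** Gives access to the library's Cauchy-Schwarz and triangle inequalities. The arguments are
    swapped because [dotmx] acts on row vectors and is conjugate-linear in its second argument. *)
Lemma inner_dotmx u v : inner u v = dotmx v^T u^T.
Proof.
rewrite dotmxE /inner !mxE; apply: eq_bigr => i _.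
by rewrite !mxE mulrC.
Qed.

Lemma innerBr u v w : inner u (v - w) = inner u v - inner u w.
Proof. by rewrite /inner mulmxBr !mxE. Qed.

Lemma innerZr u (a : R[i]) v : inner u (a *: v) = a * inner u v.
Proof. by rewrite /inner -scalemxAr mxE. Qed.

Lemma innerZl (a : R) u v : inner (a%:C *: u) v = a%:C * inner u v.
Proof.
rewrite /inner !mxE mulr_sumr; apply: eq_bigr => i _.
by rewrite !mxE rmorphM mulrA; congr (_ * _ * _); exact: conjc_real.
Qed.

Lemma inner_adj u A v : inner u (A *m v) = inner (A^t* *m u) v.
Proof. by rewrite /inner trmx_mul map_mxM trmxCK mulmxA. Qed.

Lemma inner_ge0 u : 0 <= inner u u.
Proof. by rewrite inner_dotmx dnorm_ge0. Qed.

Lemma hnorm_ge0 u : 0 <= hnorm u.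
Proof. exact: sqrtr_ge0. Qed.

Lemma hnorm_sqr u : (hnorm u ^+ 2)%:C = inner u u.
Proof.
have := inner_ge0 u; rewrite /hnorm; case: (inner u u) => a b.
rewrite lecE /= => /andP[/eqP -> a_ge0].
by rewrite sqr_sqrtr.
Qed.

Lemma hnormE u : (hnorm u)%:C = sqrtC (dotmx u^T u^T).
Proof.
by rewrite -inner_dotmx -hnorm_sqr rmorphXn /= sqrCK ?ler0c ?hnorm_ge0.
Qed.

Lemma cauchy_schwarz u v : `|inner u v| <= (hnorm u * hnorm v)%:C.
Proof.
rewrite rmorphM /= !hnormE mulrC inner_dotmx.
exact: CauchySchwarz_sqrt.
Qed.

Lemma ler_hnormD u v : hnorm (u + v) <= hnorm u + hnorm v.
Proof.
rewrite -lecR rmorphD /= !hnormE linearD /=.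
exact: triangle_lerif.
Qed.

Lemma hnormZ (a : R[i]) u : hnorm (a *: u) = Normc.normc a * hnorm u.
Proof.
apply/complexI.
rewrite rmorphM /= !hnormE linearZ /= dnormZ.
by rewrite sqrtCM ?nnegrE ?exprn_ge0 ?dnorm_ge0 ?sqrCK.
Qed.

Lemma hnorm0 : hnorm (0 : 'cV[R[i]]_n) = 0.
Proof. by rewrite -(scale0r 0) hnormZ Normc.normc0 mul0r. Qed.

Lemma hnorm_eq0 u : (hnorm u == 0) = (u == 0).
Proof.
rewrite -(inj_eq (@complexI R)) hnormE sqrt_dnorm_eq0.
exact: (raddf_eq0 _ (@trmx_inj _ _ _)).
Qed.

Lemma ler_hnorm_sum I (s : seq I) (P : pred I) (F : I -> 'cV[R[i]]_n) :
  hnorm (\sum_(i <- s | P i) F i) <= \sum_(i <- s | P i) hnorm (F i).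
Proof.
elim/big_rec2: _ => [|i y x _ le_xy]; first by rewrite hnorm0.
by apply: le_trans (ler_hnormD _ _) _; rewrite lerD2l.
Qed.

Lemma normc_le_hnorm u i : Normc.normc (u i 0) <= hnorm u.
Proof.
rewrite -(ler_pXn2r (ltn0Sn 1)) ?nnegrE ?hnorm_ge0 ?normc_ge0 //.
rewrite -lecR hnorm_sqr inner_dotmx dotmxE mxE (bigD1 i) //= !mxE -normCK.
rewrite rmorphXn /= lerDl sumr_ge0 // => j _.
by rewrite !mxE -normCK exprn_ge0.
Qed.

(** An upper bound on the operator norm in pointwise form: it passes through sums, products and
    commutators without handling suprema. *)
Definition op_le A (c : R) := forall v, hnorm (A *m v) <= c * hnorm v.

(** Each coordinate of a vector of the unit ball has modulus at most 1, so the sum of the column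
    norms is a bound. Boundedness is what makes the [sup] in [opnorm] an actual upper bound. *)
Lemma opnorm_has_ub A :
  has_ubound [set hnorm (A *m v) | v in [set v | hnorm v <= 1]]%classic.
Proof.
exists (\sum_j hnorm (col j A)) => _ [v /= v_le1 <-].
have -> : A *m v = \sum_j v j 0 *: col j A.
  apply/colP => i; rewrite summxE mxE; apply: eq_bigr => j _.
  by rewrite !mxE mulrC.
apply: le_trans (ler_hnorm_sum _ _ _) _; apply: ler_sum => j _.
rewrite hnormZ ler_piMl ?hnorm_ge0 //.
exact: le_trans (normc_le_hnorm _ _) v_le1.
Qed.

Lemma opnormP A c : opnorm A <= c -> op_le A c.
Proof.
move=> Ac v; have [-> | v_neq0] := eqVneq v 0.
  by rewrite mulmx0 hnorm0 mulr0.
have v_gt0 : 0 < hnorm v by rewrite lt_def hnorm_eq0 v_neq0 hnorm_ge0.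
have norm_inv : Normc.normc ((hnorm v)^-1)%:C = (hnorm v)^-1.
  by rewrite normc_real ger0_norm // invr_ge0 hnorm_ge0.
rewrite -ler_pdivrMr // mulrC -norm_inv -hnormZ scalemxAr.
apply: le_trans Ac; apply: (ub_le_sup (opnorm_has_ub A)) => /=.
by eexists; last reflexivity; rewrite /= hnormZ norm_inv mulVf ?gt_eqF.
Qed.

Lemma op_leW A c1 c2 : c1 <= c2 -> op_le A c1 -> op_le A c2.
Proof.
move=> le_c Ac v; apply: le_trans (Ac v) _.
by rewrite ler_wpM2r ?hnorm_ge0.
Qed.

Lemma op_leD A B a b : op_le A a -> op_le B b -> op_le (A + B) (a + b).
Proof.
move=> Aa Bb v; rewrite mulmxDl mulrDl.
by apply: le_trans (ler_hnormD _ _) _; apply: lerD.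
Qed.

Lemma op_leZ A a (z : R[i]) : op_le A a -> op_le (z *: A) (Normc.normc z * a).
Proof.
move=> Aa v; rewrite -scalemxAl hnormZ -mulrA.
by apply: ler_wpM2l => //; exact: normc_ge0.
Qed.

Lemma op_leM A B a b :
  0 <= a -> op_le A a -> op_le B b -> op_le (A * B) (a * b).
Proof.
move=> a_ge0 Aa Bb v; rewrite -[A * B]/(A *m B) -mulmxA -mulrA.
by apply: le_trans (Aa _) _; apply: ler_wpM2l.
Qed.

Lemma op_le0 : op_le 0 0.
Proof. by move=> v; rewrite mul0mx hnorm0 mul0r. Qed.

Lemma op_le_sum (I : finType) (P : pred I) (F : I -> 'M[R[i]]_n) c :
  (forall i, P i -> op_le (F i) c) ->
  op_le (\sum_(i | P i) F i) (c *+ #|[pred i | P i]|).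
Proof.
move=> Fc; rewrite -sumr_const.
by apply: (big_rec2 op_le) => [|i y x Pi]; [exact: op_le0 | apply/op_leD/Fc].
Qed.

End HilbertSpaceTheory.

(** * Commutators and the growth of powers of an operator *)

Lemma growth_step (R : realFieldType) (p q b c K d : R) :
  0 < p -> 0 <= q -> 0 <= b -> 0 <= c ->
  c * q ^+ 2 <= p ^+ 2 -> p ^+ 2 <= q * b -> b ^+ 2 <= d + K * p ^+ 2 ->
  (c - K) * p ^+ 2 <= d.
Proof.
move=> p_gt0 q_ge0 b_ge0 c_ge0 growth CS bd.
(* The hypotheses chain to c p^4 <= c q^2 b^2 <= p^2 b^2, and p^2 > 0 cancels. *)
suff: c * p ^+ 2 <= b ^+ 2 by lra.
have CS2 : p ^+ 2 * p ^+ 2 <= q ^+ 2 * b ^+ 2.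
  by rewrite -!exprMn ler_pXn2r ?nnegrE ?mulr_ge0 -?expr2 ?(ltW p_gt0).
have : p ^+ 2 * (c * p ^+ 2) <= p ^+ 2 * b ^+ 2.
  rewrite mulrCA; apply: le_trans (_ : c * (q ^+ 2 * b ^+ 2) <= _).
    exact: ler_wpM2l.
  by rewrite mulrA ler_wpM2r ?sqr_ge0.
by rewrite ler_pM2l // exprn_gt0.
Qed.

Section Commutators.
Variables (R : realType) (n : nat).
Implicit Types (A B X : 'M[R[i]]_n) (v : 'cV[R[i]]_n).

Lemma commE A B : comm A B = A * B - B * A.
Proof. by []. Qed.

Lemma comm_sumr A (I : finType) (P : pred I) (F : I -> 'M[R[i]]_n) :
  comm A (\sum_(i | P i) F i) = \sum_(i | P i) comm A (F i).
Proof. by rewrite commE mulr_sumr mulr_suml -sumrB. Qed.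

Lemma comm_suml A (I : finType) (P : pred I) (F : I -> 'M[R[i]]_n) :
  comm (\sum_(i | P i) F i) A = \sum_(i | P i) comm (F i) A.
Proof. by rewrite commE mulr_sumr mulr_suml -sumrB. Qed.

Lemma op_le_comm A B a b :
  0 <= a -> 0 <= b -> op_le A a -> op_le B b -> op_le (comm A B) (2 * a * b).
Proof.
move=> a_ge0 b_ge0 Aa Bb; rewrite commE.
have -> : 2 * a * b = a * b + Normc.normc (-1)%:C * (b * a).
  by rewrite normc_real normrN normr1; ring.
apply: op_leD; first exact: op_leM.
have -> : - (B * A) = (-1)%:C *: (B * A).
  by rewrite rmorphN rmorph1 scaleN1r.
by apply/op_leZ/op_leM.
Qed.

Lemma op_le_iter_comm A X a c k :
  0 <= a -> 0 <= c -> op_le A a -> op_le X c ->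
  op_le (iter k (comm A) X) (c * (2 * a) ^+ k).
Proof.
move=> a_ge0 c_ge0 Aa Xc; elim: k => [|k IHk] /=; first by rewrite mulr1.
rewrite exprS mulrCA; apply: op_le_comm => //.
by rewrite mulr_ge0 ?exprn_ge0 ?mulr_ge0.
Qed.

Lemma iter_comm_sum A k (I : finType) (F : I -> 'M[R[i]]_n) :
  iter k (comm A) (\sum_i F i) = \sum_i iter k (comm A) (F i).
Proof. by elim: k => //= k ->; rewrite comm_sumr. Qed.

Lemma comm_comm0 A B X : comm A B = 0 -> comm A X = 0 -> comm A (comm B X) = 0.
Proof.
rewrite !commE => /subr0_eq AB /subr0_eq AX.
rewrite mulrBr mulrBl !mulrA AB AX -!mulrA AX AB.
by rewrite !mulrA subrr.
Qed.

Lemma comm_sym0 A B : comm A B = 0 -> comm B A = 0.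
Proof. by rewrite !commE => /subr0_eq ->; rewrite subrr. Qed.

Lemma eq_iter_comm A B X k :
  (forall j, comm A (iter j (comm B) X) = comm B (iter j (comm B) X)) ->
  iter k (comm A) X = iter k (comm B) X.
Proof. by move=> AB; elim: k => //= k ->. Qed.

(* The terms [a y] with [y] outside [S] commute with [X] and with all other
   terms, hence with every iterated commutator. *)
Lemma iter_comm_local (Lam : finType) (a : Lam -> 'M[R[i]]_n)
    (S : {set Lam}) X k :
  (forall x y, comm (a x) (a y) = 0) ->
  (forall y, y \notin S -> comm X (a y) = 0) ->
  iter k (comm (\sum_y a y)) X = iter k (comm (\sum_(y in S) a y)) X.
Proof.
move=> aa Xa; apply: eq_iter_comm => j.
have Za y : y \notin S -> comm (a y) (iter j (comm (\sum_(z in S) a z)) X) = 0.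
  move=> yS; elim: j => [|j IHj]; first exact/comm_sym0/Xa.
  by apply: (comm_comm0 _ IHj); rewrite comm_sumr big1.
move: (iter j _ X) Za => Z Za.
by rewrite !comm_suml (bigID [in S]) /= [X in _ + X]big1 ?addr0.
Qed.

(** Cauchy-Schwarz applied to |A v|^2 = (v, A^* A v). *)
Lemma hnorm_mul_sqr A v :
  hnorm (A *m v) ^+ 2 <= hnorm v * hnorm (A^t* *m (A *m v)).
Proof.
have := cauchy_schwarz v (A^t* *m (A *m v)).
rewrite inner_adj trmxCK -(hnorm_sqr (A *m v)).
by rewrite ger0_norm ?lecR // sqr_ge0.
Qed.

(** The difference |A^* v|^2 - |A v|^2 is the expectation of [A, A^*] in [v]. *)
Lemma hnorm_adj_sqr A K v :
  op_le (comm A (A^t*)) K ->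
  hnorm (A^t* *m v) ^+ 2 <= hnorm (A *m v) ^+ 2 + K * hnorm v ^+ 2.
Proof.
move=> AK; rewrite -lerBlDl; apply: le_trans (ler_norm _) _.
rewrite -normc_real -lecR.
have -> : (hnorm (A^t* *m v) ^+ 2 - hnorm (A *m v) ^+ 2)%:C
          = inner v (comm A (A^t*) *m v).
  rewrite rmorphB /= /comm mulmxBl innerBr -!mulmxA; congr (_ - _).
    by rewrite inner_adj; exact: hnorm_sqr.
  by rewrite inner_adj trmxCK; exact: hnorm_sqr.
apply: le_trans (cauchy_schwarz _ _) _.
by rewrite lecR expr2 mulrCA ler_wpM2l ?hnorm_ge0.
Qed.

(* Cauchy-Schwarz makes the squared norms of [A ^+ m *m v] log-convex up to the
   commutator term [K], so their ratios drop by at most [K] at each step. *)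
Lemma hnorm_pow_growth A v K L m :
  0 <= K -> op_le (comm A (A^t*)) K -> v != 0 ->
  L * hnorm v ^+ 2 <= hnorm (A *m v) ^+ 2 ->
  0 < L - K * m%:R ->
  0 < hnorm (A ^+ m *m v) /\
  (L - K * m%:R) * hnorm (A ^+ m *m v) ^+ 2 <= hnorm (A ^+ m.+1 *m v) ^+ 2.
Proof.
move=> K_ge0 AK v_neq0 base.
elim: m => [|m IHm] Lm.
  rewrite mulr0 subr0 expr0 expr1 mul1mx; split=> //.
  by rewrite lt_def hnorm_eq0 v_neq0 hnorm_ge0.
have Lm' : 0 < L - K * m%:R.
  by apply: lt_le_trans Lm _; rewrite lerD2l lerN2 ler_wpM2l ?ler_nat.
have [um_gt0 growth] := IHm Lm'.
set um := A ^+ m *m v in um_gt0 growth; set w := A ^+ m.+1 *m v in growth *.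
have wE : w = A *m um by rewrite /w exprS -[A * _]/(A *m _) -mulmxA.
have -> : A ^+ m.+2 *m v = A *m w by rewrite exprS -[A * _]/(A *m _) -mulmxA.
(* If [w] had norm 0, the growth inequality of the previous index would bound a positive number by
   0. *)
have w_gt0 : 0 < hnorm w.
  rewrite lt_def hnorm_ge0 andbT; apply: contraTneq growth => ->.
  by rewrite expr0n -ltNge mulr_gt0 ?exprn_gt0.
split; first exact: w_gt0.
have CS : hnorm w ^+ 2 <= hnorm um * hnorm (A^t* *m w).
  by rewrite wE hnorm_mul_sqr.
have -> : L - K * m.+1%:R = L - K * m%:R - K by rewrite -natr1; ring.
exact: growth_step w_gt0 (hnorm_ge0 _) (hnorm_ge0 _) (ltW Lm') growth CS
  (hnorm_adj_sqr w AK).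
Qed.

(** Arithmetic of one peeling step: [T] is (1 + g / s)^p, [w'] and [w] are the norms before and
    after one more power of A, [x1] and [x2] bound the terms that keep X, and [y] is the term with
    the new commutator. *)
Lemma pow_bound_step (F : realFieldType) (s g c T w w' y x1 x2 : F) :
  0 < s -> 0 <= g -> 0 <= c -> 0 <= T ->
  s * w' <= w -> y <= c * g * T * w' ->
  x1 <= c * (T - 1) * w -> x2 <= c * T * w ->
  x1 + y <= c * (T * (1 + g / s) - 1) * w /\
  x2 + y <= c * (T * (1 + g / s)) * w.
Proof.
move=> s_gt0 g_ge0 c_ge0 T_ge0 ww' yw' x1w x2w.
have yw : y <= c * (g / s) * T * w.
  apply: le_trans yw' _.
  have -> : c * g * T * w' = c * (g / s) * T * (s * w').
    by field; rewrite gt_eqF.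
  by rewrite ler_wpM2l // !mulr_ge0 // invr_ge0 ltW.
move: (g / s) yw => t yw; split; lra.
Qed.

(* Peeling off one factor [A ^+ p.+1 * X = A ^+ p * (X * A + comm A X)] trades a
   power of [A], worth a factor [s], for one more commutator, worth [g]. *)
Lemma comm_pow_bound A v s g X c M p m :
  0 < s -> 0 <= g -> 0 <= c ->
  (forall j, (j < M)%N ->
     s * hnorm (A ^+ j *m v) <= hnorm (A ^+ j.+1 *m v)) ->
  (forall k, op_le (iter k (comm A) X) (c * g ^+ k)) ->
  (p + m <= M)%N ->
  hnorm (A ^+ p *m (X *m (A ^+ m *m v)) - X *m (A ^+ (p + m) *m v))
    <= c * ((1 + g / s) ^+ p - 1) * hnorm (A ^+ (p + m) *m v) /\
  hnorm (A ^+ p *m (X *m (A ^+ m *m v)))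
    <= c * (1 + g / s) ^+ p * hnorm (A ^+ (p + m) *m v).
Proof.
move=> s_gt0 g_ge0 + growth.
(* [X], [c] and [m] must vary: the induction hypothesis is used for X with power m + 1, and for
   [A, X] with constant c g. The second use needs the size estimate, hence the joint conclusion. *)
elim: p m X c => [|p IHn] m X c c_ge0 Xc pm.
  rewrite !expr0 !mul1mx add0n !subrr mulr0 mul0r hnorm0 mulr1; split=> //.
  by have := Xc 0; rewrite mulr1; exact.
have split_pow : A ^+ p.+1 *m (X *m (A ^+ m *m v))
    = A ^+ p *m (X *m (A ^+ m.+1 *m v)) + A ^+ p *m (comm A X *m (A ^+ m *m v)).
  rewrite exprSr exprS -[_ ^+ p * A]/(_ *m _) -[A * _ ^+ m]/(_ *m _).
  by rewrite /comm !mulmxBl !mulmxBr !mulmxA addrC subrK.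
have pm' : (p + m.+1 <= M)%N by rewrite addnS -addSn.
have [dX nX] := IHn m.+1 X c c_ge0 Xc pm'.
have Yc k : op_le (iter k (comm A) (comm A X)) (c * g * g ^+ k).
  by have := Xc k.+1; rewrite iterSr exprS mulrA.
have [_ nY] := IHn m (comm A X) (c * g) (mulr_ge0 c_ge0 g_ge0) Yc (ltnW pm).
have w_le : s * hnorm (A ^+ (p + m) *m v) <= hnorm (A ^+ (p + m.+1) *m v).
  by rewrite addnS; apply: growth.
have T_ge0 : 0 <= (1 + g / s) ^+ p.
  by rewrite exprn_ge0 // addr_ge0 // divr_ge0 // ltW.
have [bd1 bd2] := pow_bound_step s_gt0 g_ge0 c_ge0 T_ge0 w_le nY dX nX.
rewrite split_pow addSnnS [(1 + _) ^+ _]exprSr; split.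
  by rewrite addrAC; apply: le_trans (ler_hnormD _ _) bd1.
exact: le_trans (ler_hnormD _ _) bd2.
Qed.

End Commutators.

(** * Energy estimate for a sum of commuting local operators *)

Lemma pow_sub1_le (F : realFieldType) (t : F) M :
  0 <= t -> t * M%:R <= 1 / 2 -> (1 + t) ^+ M - 1 <= 2 * (t * M%:R).
Proof.
move=> t_ge0 tM.
(* The inductive step is (1 + t)(1 - t (m + 1)) <= 1 - t m. With y = t M <= 1/2 and T = (1 + t)^M, T
   (1 - y) <= 1 gives T <= 2, then T - 1 <= y T <= 2 y. *)
have pow_le m : (1 + t) ^+ m * (1 - t * m%:R) <= 1.
  elim: m => [|m IHm]; first by rewrite mulr0 subr0 mulr1.
  apply: le_trans IHm; rewrite exprSr -mulrA ler_wpM2l ?exprn_ge0 ?addr_ge0 //.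
  have := mulr_ge0 (mulr_ge0 t_ge0 t_ge0) (ler0n F m.+1).
  by rewrite -natr1; lra.
have T_ge0 : 0 <= (1 + t) ^+ M by rewrite exprn_ge0 ?addr_ge0.
have := pow_le M; move: tM (mulr_ge0 t_ge0 (ler0n F M)) T_ge0.
move: (t * M%:R) ((1 + t) ^+ M) => y T; nra.
Qed.

Section Ladder.
Variables (R : realType) (n : nat).
Implicit Types (A H : 'M[R[i]]_n) (u v Phi : 'cV[R[i]]_n).

Lemma parallelogram u v :
  hnorm (u + v) ^+ 2 + hnorm (u - v) ^+ 2
    = 2 * (hnorm u ^+ 2 + hnorm v ^+ 2).
Proof.
have innerDl (x y z : 'cV[R[i]]_n) : inner (x + y) z = inner x z + inner y z.
  by rewrite /inner linearD /= map_mxD mulmxDl mxE.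
have innerNl (x z : 'cV[R[i]]_n) : inner (- x) z = - inner x z.
  by rewrite /inner linearN /= map_mxN mulNmx mxE.
have innerDr (x y z : 'cV[R[i]]_n) : inner x (y + z) = inner x y + inner x z.
  by rewrite /inner mulmxDr mxE.
have E : inner (u + v) (u + v) + inner (u - v) (u - v)
         = (1 + 1) * (inner u u + inner v v).
  by rewrite !innerDl !innerNl innerBr innerDr innerBr innerDr; ring.
apply/complexI; rewrite rmorphD [RHS]rmorphM [in RHS]rmorphD [in RHS]rmorphD.
by rewrite rmorph1 -!hnorm_sqr in E *.
Qed.

(** The energy shift equals -(v, E v - H v) / |v|^2, to which Cauchy-Schwarz applies. *)
Lemma energy_normalize H v (E B : R) :
  0 < hnorm v -> hnorm (E%:C *: v - H *m v) <= B * hnorm v ->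
  `|inner (normalize v) (H *m normalize v) - E%:C| <= B%:C.
Proof.
move=> v_gt0 HB; set c := (hnorm v)^-1.
have c_ge0 : 0 <= c by rewrite invr_ge0 ltW.
have vv : (c * c)%:C * inner v v = 1.
  by rewrite -hnorm_sqr -rmorphM /= /c -expr2 -exprMn mulVf ?gt_eqF ?expr1n.
have -> : inner (normalize v) (H *m normalize v) - E%:C
          = - ((c * c)%:C * inner v (E%:C *: v - H *m v)).
  rewrite /normalize -/c innerZl -scalemxAr innerZr innerBr innerZr rmorphM.
  rewrite -[E%:C in LHS]mulr1 -vv rmorphM /=; ring.
rewrite normrN normrM ger0_norm ?ler0c ?mulr_ge0 //.
have -> : B = c * c * (hnorm v * (B * hnorm v)).
  by rewrite /c; field; rewrite gt_eqF.
rewrite [leRHS]rmorphM /= ler_wpM2l ?ler0c ?mulr_ge0 //.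
by apply: le_trans (cauchy_schwarz _ _) _; rewrite lecR ler_wpM2l ?hnorm_ge0.
Qed.

Variables (Lam : finType) (hx a : Lam -> 'M[R[i]]_n) (supp : Lam -> {set Lam}).
Variables (h o mu : R) (r M : nat) (Phi : 'cV[R[i]]_n).
Let N : R := #|Lam|%:R.
(** [A] plays the role of O^+ or O^-, and [a x] that of its local term; hence the bound 2 o on [a x]
    and on its adjoint. *)
Let A := \sum_x a x.
Let H := \sum_x hx x.

Hypotheses (h_gt0 : 0 < h) (o_gt0 : 0 < o) (mu01 : 0 < mu <= 1).
Hypotheses (r_ge2 : (2 <= r)%N) (N_gt0 : 0 < N).
Hypothesis M_small : M%:R / N <= mu ^+ 2 / (8 * r%:R).
Hypothesis aa0 : forall x y, comm (a x) (a y) = 0.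
Hypothesis aadj0 : forall x y, x != y -> comm (a x) ((a y)^t*) = 0.
Hypothesis supp_card : forall x, (#|supp x| <= r)%N.
Hypothesis ha0 : forall x y, y \notin supp x -> comm (hx x) (a y) = 0.
Hypothesis h_le : forall x, op_le (hx x) h.
Hypothesis a_le : forall x, op_le (a x) (2 * o).
Hypothesis aadj_le : forall x, op_le ((a x)^t*) (2 * o).
Hypothesis Phi1 : hnorm Phi = 1.
Hypothesis long_range :
  4 * (mu * o * N) ^+ 2 <= hnorm (A *m Phi) ^+ 2 + hnorm (A^t* *m Phi) ^+ 2.

Let s := mu * o * N.
Let w m := hnorm (A ^+ m *m Phi).

(** Terms at distinct sites commute, so only the N diagonal commutators remain, each of norm at most
    2 (2 o)(2 o). *)
Lemma comm_adj_le : op_le (comm A (A^t*)) (8 * o ^+ 2 * N).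
Proof.
have -> : comm A (A^t*) = \sum_x comm (a x) ((a x)^t*).
  rewrite /A !raddf_sum comm_suml; apply: eq_bigr => x _.
  rewrite comm_sumr (bigD1 x) //= big1 ?addr0 // => y yx.
  by apply: aadj0; rewrite eq_sym.
have -> : 8 * o ^+ 2 * N = (2 * (2 * o) * (2 * o)) *+ #|Lam|.
  by rewrite -[RHS]mulr_natr -/N; ring.
by apply: op_le_sum => x _; apply: op_le_comm => //; rewrite mulr_ge0 ?ltW.
Qed.

(** Against a single h_x, [A] can be replaced by its at most r terms in the support, an operator of
    norm at most 2 o r. Each commutator then costs 4 o r, and the sum over x gives the factor N. *)
Lemma iter_comm_ham_le k :
  op_le (iter k (comm A) H) (h * N * (4 * o * r%:R) ^+ k).
Proof.
rewrite /H iter_comm_sum.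
have -> : h * N * (4 * o * r%:R) ^+ k
          = (h * (2 * (2 * o * r%:R)) ^+ k) *+ #|Lam|.
  rewrite -[RHS]mulr_natr -/N.
  have -> : 2 * (2 * o * r%:R) = 4 * o * r%:R by ring.
  by ring.
apply: op_le_sum => x _; rewrite (iter_comm_local _ aa0 (@ha0 x)).
have o2_ge0 : 0 <= 2 * o by rewrite mulr_ge0 ?ltW.
have AS_le : op_le (\sum_(y in supp x) a y) (2 * o * r%:R).
  apply: (op_leW _ (op_le_sum (fun y _ => a_le y))).
  by rewrite -[_ *+ _]mulr_natr ler_wpM2l ?ler_nat ?supp_card.
by apply: op_le_iter_comm AS_le (h_le x); rewrite ?mulr_ge0 // ltW.
Qed.

Lemma ladder_growth m : (m < M)%N -> s * w m <= w m.+1.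
Proof.
move=> mM.
have [mu_gt0 mu_le1] := andP mu01.
have s_gt0 : 0 < s by rewrite !mulr_gt0.
have r_gt0 : 0 < r%:R :> R by rewrite ltr0n (leq_trans _ r_ge2).
pose K := 8 * o ^+ 2 * N.
(* Long range order only bounds |A Phi|^2 + |A^* Phi|^2 from below, by 4 s^2. As the second term
   exceeds the first by at most K, the first is at least 2 s^2 - K / 2. *)
pose L := 2 * s ^+ 2 - K / 2.
have base : L * hnorm Phi ^+ 2 <= hnorm (A *m Phi) ^+ 2.
  have half (x y z : R) :
      4 * z <= x + y -> y <= x + K * 1 -> (2 * z - K / 2) * 1 <= x.
    by lra.
  have := hnorm_adj_sqr Phi comm_adj_le; rewrite Phi1 expr1n.
  exact: half long_range.
have K_ge0 : 0 <= K by rewrite !mulr_ge0 ?sqr_ge0 ?ltW.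
have Phi_neq0 : Phi != 0 by rewrite -hnorm_eq0 Phi1 oner_eq0.
(* This is the smallness assumption on M / N, multiplied by 8 o^2 N^2. *)
have KM : K * M%:R <= s ^+ 2 / r%:R.
  have -> : K * M%:R = 8 * o ^+ 2 * N ^+ 2 * (M%:R / N).
    by rewrite /K; field; rewrite gt_eqF.
  have -> : s ^+ 2 / r%:R = 8 * o ^+ 2 * N ^+ 2 * (mu ^+ 2 / (8 * r%:R)).
    by rewrite /s; field; rewrite gt_eqF.
  by rewrite ler_wpM2l // !mulr_ge0 ?(ltW o_gt0) ?(ltW N_gt0).
have sr : s ^+ 2 / r%:R <= s ^+ 2.
  by rewrite ler_piMr ?sqr_ge0 // invf_le1 // ler1n (leq_trans _ r_ge2).
(* Since m < M, K (m + 1) <= s^2; the extra K absorbs the K / 2 lost in [L]. *)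
have Lm : s ^+ 2 <= L - K * m%:R.
  have aux (x k y : R) : 0 <= k -> y + k * 1 <= x -> x <= 2 * x - k / 2 - y.
    by lra.
  apply: aux => //; rewrite -mulrDr natr1.
  by apply: le_trans (le_trans KM sr); rewrite ler_wpM2l ?ler_nat.
have Lm_gt0 : 0 < L - K * m%:R by apply: lt_le_trans Lm; rewrite exprn_gt0.
have [wm_gt0 growth] :=
  hnorm_pow_growth K_ge0 comm_adj_le Phi_neq0 base Lm_gt0.
have sw_ge0 : 0 <= s * w m by apply: mulr_ge0 (ltW s_gt0) (ltW wm_gt0).
have le_of_sqr (x y : R) : 0 <= x -> 0 <= y -> x ^+ 2 <= y ^+ 2 -> x <= y.
  by move=> x_ge0 y_ge0; rewrite ler_pXn2r.
apply: le_of_sqr sw_ge0 (hnorm_ge0 _) _.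
by apply: le_trans growth; rewrite exprMn; apply: ler_wpM2r Lm; apply: sqr_ge0.
Qed.

Lemma ladder_bound :
  0 < w M /\
  hnorm (A ^+ M *m (H *m Phi) - H *m (A ^+ M *m Phi))
    <= 8 * h * r%:R / mu * M%:R * w M.
Proof.
have [mu_gt0 mu_le1] := andP mu01.
have s_gt0 : 0 < s by rewrite !mulr_gt0.
have r_gt0 : 0 < r%:R :> R by rewrite ltr0n (leq_trans _ r_ge2).
have w_gt0 m : (m <= M)%N -> 0 < w m.
  elim: m => [|m IHm] mM; first by rewrite /w expr0 mul1mx Phi1.
  by apply: lt_le_trans (ladder_growth mM); rewrite mulr_gt0 // IHm // ltnW.
split; first exact: w_gt0.
pose g := 4 * o * r%:R.
have g_ge0 : 0 <= g by rewrite !mulr_ge0 ?ltW.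
have hN_ge0 : 0 <= h * N by rewrite mulr_ge0 ?ltW.
have M0 : (M + 0 <= M)%N by rewrite addn0.
(* All M factors are peeled off, starting from Phi itself: p = M and m = 0. *)
have [+ _] :=
  comm_pow_bound s_gt0 g_ge0 hN_ge0 ladder_growth iter_comm_ham_le M0.
rewrite addn0 expr0 mul1mx => /le_trans; apply.
rewrite ler_wpM2r ?hnorm_ge0 //.
have gs : g / s = 4 * r%:R / (mu * N).
  by rewrite /g /s; field; rewrite !gt_eqF.
have gsM : g / s * M%:R <= 1 / 2.
  have -> : g / s * M%:R = 4 * r%:R / mu * (M%:R / N).
    by rewrite gs; field; rewrite !gt_eqF.
  apply: le_trans (_ : 4 * r%:R / mu * (mu ^+ 2 / (8 * r%:R)) <= _).
    by rewrite ler_wpM2l // !mulr_ge0 ?invr_ge0 ?ltW.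
  have -> : 4 * r%:R / mu * (mu ^+ 2 / (8 * r%:R)) = mu / 2.
    by field; rewrite !gt_eqF.
  by rewrite ler_wpM2r ?invr_ge0.
(* The N of |H| <= h N cancels against g / s = 4 r / (mu N), which leaves a bound proportional to M
   alone. *)
have -> : 8 * h * r%:R / mu * M%:R = h * N * (2 * (g / s * M%:R)).
  by rewrite gs; field; rewrite !gt_eqF.
by rewrite ler_wpM2l // pow_sub1_le // divr_ge0 // ltW.
Qed.

End Ladder.

(** * The order operators O^+ and O^- as ladder operators *)

Lemma hermsymmx_adj (R : realType) n (A : 'M[R[i]]_n) :
  A \is hermsymmx -> A^t* = A.
Proof. by move/is_hermitianmxP => {2}->; rewrite expr0 scale1r. Qed.

Lemma comm0DZr (R : realType) n (A B C : 'M[R[i]]_n) (z : R[i]) :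
  comm A B = 0 -> comm A C = 0 -> comm A (B + z *: C) = 0.
Proof.
rewrite /comm => /subr0_eq AB /subr0_eq AC.
by rewrite mulmxDr mulmxDl -scalemxAl -scalemxAr AB AC subrr.
Qed.

Lemma comm0DZl (R : realType) n (A B C : 'M[R[i]]_n) (z : R[i]) :
  comm B A = 0 -> comm C A = 0 -> comm (B + z *: C) A = 0.
Proof. by move=> BA CA; apply/comm_sym0/comm0DZr; apply/comm_sym0. Qed.

Section LadderOperator.
Variables (R : realType) (Lam : finType) (d : Lam -> nat) (Q : u1_system R d).
(* [z = 'i] gives O^+ and [z = - 'i] gives O^-. *)
Variable z : R[i].
Hypotheses (z_imag : Num.conj z = - z) (z_unit : Normc.normc z = 1).

Let ladder := ord Q 0 + z *: ord Q 1.
Let ladder_loc x := ord_loc Q 0 x + z *: ord_loc Q 1 x.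

Lemma ladderE : ladder = \sum_x ladder_loc x.
Proof. by rewrite big_split /= -scaler_sumr. Qed.

(** Since [z] is purely imaginary, conjugation flips the sign of the second term; thus O^+ and O^-
    are adjoint to each other. *)
Lemma adjDZ n (A B : 'M[R[i]]_n) :
  A^t* = A -> B^t* = B -> (A + z *: B)^t* = A - z *: B.
Proof.
move=> hA hB.
rewrite -[in RHS]hA -[in RHS]hB; apply/matrixP => i j.
by rewrite !mxE rmorphD rmorphM -mulNr -z_imag.
Qed.

Lemma ord_adj alpha : (ord Q alpha)^t* = ord Q alpha.
Proof.
rewrite /ord !raddf_sum; apply: eq_bigr => x _.
exact/hermsymmx_adj/ord_loc_selfadj.
Qed.

Lemma ladder_loc_adj x : (ladder_loc x)^t* = ord_loc Q 0 x - z *: ord_loc Q 1 x.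
Proof. by apply: adjDZ; apply/hermsymmx_adj/ord_loc_selfadj. Qed.

(** Parallelogram identity for O^(1) v and z O^(2) v, with |z| = 1. Long range order makes the
    right-hand side at least 4 (mu o N)^2 at v = Phi. *)
Lemma hnorm_ladder_sqr v :
  hnorm (ladder *m v) ^+ 2 + hnorm (ladder^t* *m v) ^+ 2
    = 2 * (hnorm (ord Q 0 *m v) ^+ 2 + hnorm (ord Q 1 *m v) ^+ 2).
Proof.
rewrite (adjDZ (ord_adj 0) (ord_adj 1)) mulmxDl mulmxBl.
apply: etrans (parallelogram _ _) _.
by rewrite -scalemxAl hnormZ z_unit mul1r.
Qed.

Lemma inner_ord_sqr alpha v :
  inner v (ord Q alpha ^+ 2 *m v) = (hnorm (ord Q alpha *m v) ^+ 2)%:C.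
Proof.
rewrite expr2 -[_ * _]/(_ *m _) -mulmxA inner_adj ord_adj.
exact/esym/hnorm_sqr.
Qed.

Lemma ladder_energy (h o mu E : R) (r k : nat) supp (Phi : state R d) :
  let N : R := #|Lam|%:R in
  0 < h -> 0 < o -> 0 < mu <= 1 -> (2 <= r)%N -> 0 < N ->
  hnorm Phi = 1 ->
  ham Q *m Phi = E%:C *: Phi ->
  (forall x y alpha beta, x != y ->
     comm (ord_loc Q alpha x) (ord_loc Q beta y) = 0) ->
  (forall x : Lam, (#|supp x : {set Lam}| <= r)%N) ->
  (forall x y alpha, y \notin supp x ->
     comm (ham_loc Q x) (ord_loc Q alpha y) = 0) ->
  (forall x, opnorm (ham_loc Q x) <= h) ->
  (forall x alpha, opnorm (ord_loc Q alpha x) <= o) ->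
  inner Phi (ord Q 0 ^+ 2 *m Phi) = inner Phi (ord Q 1 ^+ 2 *m Phi) ->
  ((mu * o * N) ^+ 2)%:C <= inner Phi (ord Q 1 ^+ 2 *m Phi) ->
  k%:R / N <= mu ^+ 2 / (8 * r%:R) ->
  let v := ladder ^+ k *m Phi in
  v != 0 /\
  `|inner (normalize v) (ham Q *m normalize v) - E%:C|
    <= (8 * h * r%:R / mu * k%:R)%:C.
Proof.
have sum_le (x y y' : R) : y = y' -> x <= y' -> 4 * x <= 2 * (y + y').
  by move=> ? ?; lra.
move=> N h_gt0 o_gt0 mu01 r_ge2 N_gt0 Phi1 HPhi oo supp_card ho h_le o_le.
rewrite !inner_ord_sqr => /complexI eq01 + kN v; rewrite lecR => lro.
have loc_comm x y : comm (ladder_loc x) (ladder_loc y) = 0.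
  have [-> | xy] := eqVneq x y; first by rewrite commE subrr.
  by apply: comm0DZl; apply: comm0DZr; apply: oo.
have loc_adj_comm x y : x != y -> comm (ladder_loc x) ((ladder_loc y)^t*) = 0.
  move=> xy; rewrite ladder_loc_adj -scaleNr.
  by apply: comm0DZl; apply: comm0DZr; apply: oo.
have ham_loc_comm x y :
    y \notin supp x -> comm (ham_loc Q x) (ladder_loc y) = 0.
  by move=> yx; apply: comm0DZr; apply: ho.
have op_le_DZ (t : R[i]) x : Normc.normc t = 1 ->
    op_le (ord_loc Q 0 x + t *: ord_loc Q 1 x) (2 * o).
  move=> t1; have -> : 2 * o = o + Normc.normc t * o by rewrite t1; ring.
  by apply: op_leD; [|apply: op_leZ]; apply/opnormP/o_le.
have loc_le x : op_le (ladder_loc x) (2 * o) by apply: op_le_DZ.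
have loc_adj_le x : op_le ((ladder_loc x)^t*) (2 * o).
  rewrite ladder_loc_adj -scaleNr; apply: op_le_DZ.
  by rewrite -z_unit; apply: normcN.
have long_range : 4 * (mu * o * N) ^+ 2
    <= hnorm (ladder *m Phi) ^+ 2 + hnorm (ladder^t* *m Phi) ^+ 2.
  by rewrite hnorm_ladder_sqr; apply: sum_le eq01 lro.
rewrite ladderE in long_range.
have [v_gt0 bound] := ladder_bound h_gt0 o_gt0 mu01 r_ge2 N_gt0 kN loc_comm
  loc_adj_comm supp_card ham_loc_comm (fun x => opnormP (h_le x)) loc_le
  loc_adj_le Phi1 long_range.
rewrite -ladderE -/(ham Q) in v_gt0 bound.
split; first by rewrite -hnorm_eq0 gt_eqF.
apply: energy_normalize v_gt0 _.
(* As H Phi = E Phi, the vector E v - H v is the commutator of the k-th power with H, applied to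
   Phi. *)
by rewrite [E%:C *: v]scalemxAr -HPhi.
Qed.

End LadderOperator.

Theorem theorem3 (R : realType) (h : R) (r : nat) (mu : R) :
  0 < h -> (2 <= r)%N -> 0 < mu <= 1 ->
  exists c1 : R,
  forall (Lam : finType) (d : Lam -> nat) (Q : u1_system R d)
         (o : R) (supp : Lam -> {set Lam})
         (Phi : state R d) (E : R) (q : R[i]) (M : int),
    let N : R := #|Lam|%:R in
    0 < o ->
    hnorm Phi = 1 ->
    is_eigenstate (ham Q) E%:C Phi ->
    is_eigenstate (charge Q) q Phi ->
    (* i) *)
    (forall (x y : Lam) (alpha beta : 'I_2), x != y ->
       comm (ord_loc Q alpha x) (ord_loc Q beta y) = 0) ->
    (* ii) *)
    (forall x : Lam, (#|supp x| <= r)%N) ->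
    (forall (x y : Lam) (alpha : 'I_2), y \notin supp x ->
       comm (ham_loc Q x) (ord_loc Q alpha y) = 0) ->
    (* iii) *)
    (forall x : Lam, opnorm (ham_loc Q x) <= h) ->
    (forall (x : Lam) (alpha : 'I_2), opnorm (ord_loc Q alpha x) <= o) ->
    (* iv) *)
    inner Phi (ord Q 0 ^+ 2 *m Phi) = inner Phi (ord Q 1 ^+ 2 *m Phi) ->
    ((mu * o * N) ^+ 2)%:C <= inner Phi (ord Q 1 ^+ 2 *m Phi) ->
    M != 0 ->
    (4 * r%:R / mu) ^+ 2 <= N ->
    `|M|%N%:R / N <= mu ^+ 2 / (8 * r%:R) ->
    ord_plus_pow Q M *m Phi != 0 /\
    let Psi := tower_state Q M Phi in
    (N^-1)%:C * `|inner Psi (ham Q *m Psi) - E%:C|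
      <= (c1 * (`|M|%N%:R / N))%:C.
Proof.
(* The constant comes from [ladder_bound]; the size [o] has cancelled in g / s. *)
move=> h_gt0 r_ge2 mu01; exists (8 * h * r%:R / mu).
have rmu_gt0 : 0 < 4 * r%:R / mu.
  by rewrite divr_gt0 ?mulr_gt0 ?ltr0n ?(leq_trans _ r_ge2) //; case/andP: mu01.
move=> Lam d Q o supp Phi E q M N o_gt0 Phi1 [_ HPhi] _ oo supp_card ho.
move=> h_le o_le eq01 lro _ N_ge MN.
(* The lower bound on [N] rules out the empty lattice, where division by [N] would return the
   default value 0. *)
have N_gt0 : 0 < N by apply: lt_le_trans N_ge; exact: exprn_gt0.
have conj_i : Num.conj ('i : R[i]) = - 'i.
  by apply/eqP; rewrite eq_complex; apply/andP; rewrite /= oppr0.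
have conj_Ni : Num.conj (- 'i : R[i]) = - - 'i.
  exact: etrans (rmorphN _ _) (congr1 _ conj_i).
have norm_i : Normc.normc ('i : R[i]) = 1.
  by rewrite /= expr0n expr1n add0r sqrtr1.
have ladder_z (z : R[i]) (k : nat) : Num.conj z = - z -> Normc.normc z = 1 ->
    k%:R / N <= mu ^+ 2 / (8 * r%:R) ->
    let v := (ord Q 0 + z *: ord Q 1) ^+ k *m Phi in
    v != 0 /\ (N^-1)%:C * `|inner (normalize v) (ham Q *m normalize v) - E%:C|
      <= (8 * h * r%:R / mu * (k%:R / N))%:C.
  move=> z_imag z_unit kN v.
  have [v_neq0 bound] := ladder_energy z_imag z_unit h_gt0 o_gt0 mu01 r_ge2
    N_gt0 Phi1 HPhi oo supp_card ho h_le o_le eq01 lro kN.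
  split; first exact: v_neq0.
  rewrite mulrA [_ / N]mulrC [leRHS]rmorphM ler_wpM2l //.
  by rewrite ler0c invr_ge0 ltW.
(* Nonnegative M uses z = i with power k; [Negz k] uses z = -i with power k + 1, which is |M|. *)
case: M MN => [k | k] /= kN.
  exact: ladder_z.
rewrite /tower_state /ord_plus_pow /ord_minus -scaleNr.
apply: ladder_z conj_Ni _ kN.
by rewrite normcN.
Qed.
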